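(* Suppose that the fundamental group $\pi$ of $G$ has at least two generators (is free of rank at least $2$). Let $f:G\to G$ be a continuous map that is homotopic to the identity and permutes the vertices of $G$ so that the vertices form one periodic orbit. Let $w^{1/v}$ denote the rotation element of one of the vertices $V$ (so $f^v(V)=V$ and $\widetilde f^v(\widetilde V)=w\widetilde V$). If every edge of $G$ belongs to $w$, then $f$ has infinitely many periodic orbits with different rotation elements; that is, there is an infinite set of periodic points of $f$, lying in pairwise different periodic orbits, whose rotation elements are pairwise different.
   Context: $G$ is a finite connected directed graph (multiple edges allowed, no looped edges) with base vertex $x_0$; $\pi=\pi_1(G,x_0)$, a free group; $\widetilde G$ is the universal cover of $G$, a tree. Elements of $\pi$ are identified with covering transformations of $\widetilde G$ (after fixing a lift $\widetilde x_0$ of $x_0$, the lift at $\widetilde x_0$ of a loop in class $\gamma$ ends at $\gamma\widetilde x_0$), and products act by $(\alpha\beta)\widetilde x=\alpha(\beta\widetilde x)$. Coherent labeling: choose a spanning tree $\mathcal T$ of $G$ rooted at $x_0$ and lift it to a tree in $\widetilde G$ through $\widetilde x_0$; this defines the chosen lifts $\widetilde V$ of all vertices and $\widetilde E$ of all edges of $\mathcal T$. For an edge $E\notin\mathcal T$ with initial vertex $V$, $\widetilde E$ is the lift of $E$ starting at $\widetilde V$. For $x$ in the interior of an edge $E$, $\widetilde x$ is the point of $\widetilde E$ over $x$; for a vertex, $\widetilde x$ is its chosen lift. All labelings are coherent. $\widetilde f$ is a fixed lift of $f$ with $\widetilde f(\gamma\widetilde x)=\gamma\widetilde f(\widetilde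 x)$ for all $\gamma\in\pi$. Rotation element: for $x\in\mathrm{Fix}(f^n)$, let $w\in\pi$ satisfy $\widetilde f^n(\widetilde x)=w\widetilde x$; then $\rho(x)=w^{1/n}$. Rational powers are formal, modulo $(w^k)^r=w^{kr}$ for integers $k$ and rationals $r$ (equivalently they lie in the free $\mathbb Q$-group, where $w^{1/n}=v^{1/m}$ iff $w^m=v^n$). Belonging: an edge loop in $G$ is cyclically reduced when its first edge is not the reverse of its last edge (and it has no backtracking). Every loop can be contracted onto a cyclically reduced loop by changing the base point to another vertex of the loop and canceling adjacent inverse edges; the result is called a cyclic reduction. An edge $E$ belongs to $\alpha\in\pi$ when every cyclic reduction of $\alpha$ uses $E$ or $E^{-1}$. *)

(* Defs.v *)
From HB Require Import structures.
From mathcomp Require Import all_boot all_order all_algebra.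
From mathcomp Require Import all_classical all_reals all_analysis.

Set Implicit Arguments.
Unset Strict Implicit.
Unset Printing Implicit Defensive.

Import Order.TTheory GRing.Theory Num.Theory.
Import numFieldNormedType.Exports.

Local Open Scope classical_set_scope.
Local Open Scope ring_scope.

(* Possibly infinite, so that universal covers are digraphs too. *)
Record digraph := Digraph {
  vertex : choiceType;
  edge : choiceType;
  src : edge -> vertex;
  tgt : edge -> vertex }.

Record finDigraph := FinDigraph {
  fvertex : finType;
  fedge : finType;
  fsrc : fedge -> fvertex;
  ftgt : fedge -> fvertex;
  loopless : forall e, fsrc e != ftgt e }.

Definition digraph_of_fin (G : finDigraph) : digraph :=
  @Digraph (fvertex G) (fedge G) (@fsrc G) (@ftgt G).
Coercion digraph_of_fin : finDigraph >-> digraph.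

Section Realization.
Variable R : realType.

(* The topological space of a digraph: its vertices, together with a copy of
   the open interval ]0, 1[ for each edge. *)
Inductive realization (G : digraph) : Type :=
| Vtx of vertex G
| Inn of edge G & {t : R | 0 < t < 1}.

HB.instance Definition _ (G : digraph) := gen_eqMixin (realization G).
HB.instance Definition _ (G : digraph) := gen_choiceMixin (realization G).

(* The characteristic map of a closed edge, [0, 1] -> realization G, extended
   to R by precomposing with the retraction of R onto [0, 1]. *)
Definition charmap (G : digraph) (e : edge G) (t : R) : realization G :=
  if t <= 0 then Vtx (src e)
  else if insub t is Some u then Inn e u else Vtx (tgt e).

(* The CW topology. For a vertex without edges every neighbourhood condition is
   void, so such a vertex is an isolated point, as it should be. *)
Definition cw_open (G : digraph) : set (set (realization G)) :=
  [set U | forall e : edge G, open (charmap e @^-1` U)].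

Lemma cw_openT (G : digraph) : @cw_open G setT.
Proof. by move=> e; rewrite preimage_setT; exact: openT. Qed.

Lemma cw_openI (G : digraph) : setI_closed (@cw_open G).
Proof. by move=> A B oA oB e; rewrite preimage_setI; exact: openI. Qed.

Lemma cw_open_bigU (G : digraph) (I : Type) (U : I -> set (realization G)) :
  (forall i, cw_open (U i)) -> cw_open (\bigcup_i U i).
Proof.
move=> oU e; rewrite preimage_bigcup.
by apply: bigcup_open => i _; exact: oU.
Qed.

HB.instance Definition _ (G : digraph) :=
  isOpenTopological.Build (realization G)
    (@cw_openT G) (@cw_openI G) (@cw_open_bigU G).

End Realization.

Arguments Vtx {R G}.
Arguments Inn {R G}.

Section Homotopy.
Variables (R : realType) (X Y : topologicalType).

Definition homotopic (f g : X -> Y) : Prop :=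
  exists H : R * X -> Y,
    [/\ {within `[0, 1]%classic `*` [set: X], continuous H},
        forall x, H (0, x) = f x & forall x, H (1, x) = g x].

End Homotopy.

Section EdgePaths.
Variable G : digraph.

(* An oriented edge: (e, true) is e, and (e, false) is e traversed backwards. *)
Definition dart : Type := (edge G * bool)%type.
HB.instance Definition _ := Choice.on dart.

Definition dsrc (d : dart) : vertex G := if d.2 then src d.1 else tgt d.1.
Definition dtgt (d : dart) : vertex G := if d.2 then tgt d.1 else src d.1.
Definition dinv (d : dart) : dart := (d.1, ~~ d.2).

Fixpoint walk (x : vertex G) (s : seq dart) : bool :=
  if s is d :: s' then (dsrc d == x) && walk (dtgt d) s' else true.
Definition wend (x : vertex G) (s : seq dart) : vertex G :=
  last x (map dtgt s).

Definition connected_digraph : Prop :=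
  forall x y : vertex G, exists2 s, walk x s & wend x s = y.

Definition no_backtrack (d d' : dart) : bool := d' != dinv d.
Definition reduced (s : seq dart) : bool := sorted no_backtrack s.
(* [path.cycle] also compares the last edge with the first one. *)
Definition cyc_reduced (s : seq dart) : bool := path.cycle no_backtrack s.

Definition cons_red (d : dart) (s : seq dart) : seq dart :=
  if s is d' :: s' then if d' == dinv d then s' else d :: s else [:: d].
Definition red (s : seq dart) : seq dart := foldr cons_red [::] s.
Definition rev_path (s : seq dart) : seq dart := rev (map dinv s).

Inductive contracts : seq dart -> seq dart -> Prop :=
| contracts_refl s : contracts s s
| contracts_base s1 s2 t : contracts (s2 ++ s1) t -> contracts (s1 ++ s2) t
| contracts_cancel s1 d s2 t :
    contracts (s1 ++ s2) t -> contracts (s1 ++ [:: d; dinv d] ++ s2) t.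

Definition cyclic_reduction (s t : seq dart) : Prop :=
  contracts s t /\ cyc_reduced t.

Lemma dinvK : involutive dinv.
Proof. by case=> e b; rewrite /dinv negbK. Qed.

Lemma dsrc_inv d : dsrc (dinv d) = dtgt d.
Proof. by case: d => e []. Qed.

Lemma dtgt_inv d : dtgt (dinv d) = dsrc d.
Proof. by case: d => e []. Qed.

Lemma walk_cat x s t : walk x (s ++ t) = walk x s && walk (wend x s) t.
Proof. by elim: s x => //= d s IHs x; rewrite IHs andbA. Qed.

Lemma wend_cat x s t : wend x (s ++ t) = wend (wend x s) t.
Proof. by rewrite /wend map_cat last_cat. Qed.

Lemma cons_red_reduced d s : reduced s -> reduced (cons_red d s).
Proof.
case: s => //= d' s hs; case: ifPn => [_|ne]; first exact: path_sorted hs.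
by rewrite /reduced /= /no_backtrack ne.
Qed.

Lemma foldr_cons_red_reduced s r : reduced r -> reduced (foldr cons_red r s).
Proof. by move=> hr; elim: s => //= d s; exact: cons_red_reduced. Qed.

Lemma red_reduced s : reduced (red s).
Proof. exact: foldr_cons_red_reduced. Qed.

Lemma red_id s : reduced s -> red s = s.
Proof.
elim: s => //= d s IHs hs; rewrite IHs; last exact: path_sorted hs.
by case: s hs {IHs} => //= d' s /andP[/negbTE ->].
Qed.

Lemma cons_redK d s : reduced s -> cons_red (dinv d) (cons_red d s) = s.
Proof.
case: s => [_|d' s hs] /=; first by rewrite dinvK eqxx.
case: eqP => [e|_] /=; last by rewrite dinvK eqxx.
rewrite e in hs *; case: s hs => //= d'' s /andP[/negbTE hd _].
by move: hd; rewrite /no_backtrack => ->.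
Qed.

Lemma cons_redVK d s : reduced s -> cons_red d (cons_red (dinv d) s) = s.
Proof. by move=> hs; rewrite -{1}(dinvK d) cons_redK. Qed.

Lemma foldr_red s r : reduced r ->
  foldr cons_red r (red s) = foldr cons_red r s.
Proof.
move=> hr; elim: s => //= d s IHs; rewrite -IHs.
case E: (red s) => [|d' s'] //=; case: eqP => //= ->.
by rewrite cons_redVK // foldr_cons_red_reduced.
Qed.

Lemma red_cat s t : red (s ++ t) = foldr cons_red (red t) s.
Proof. by rewrite /red foldr_cat. Qed.

Lemma red_catl s t : red (red s ++ t) = red (s ++ t).
Proof. by rewrite !red_cat foldr_red // red_reduced. Qed.

Lemma red_catr s t : red (s ++ red t) = red (s ++ t).
Proof. by rewrite !red_cat (red_id (red_reduced t)). Qed.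

Lemma red_rev_catl s : red (rev_path s ++ s) = [::].
Proof.
elim: s => //= d s IHs.
rewrite /rev_path /= rev_cons -cats1 -catA -[LHS]red_catr /=.
by rewrite cons_redK ?red_reduced // red_catr.
Qed.

Lemma rev_pathK : involutive rev_path.
Proof.
move=> s; rewrite /rev_path map_rev revK -map_comp map_id_in // => d _.
exact: dinvK.
Qed.

Lemma red_rev_catr s : red (s ++ rev_path s) = [::].
Proof. by rewrite -{1}(rev_pathK s) red_rev_catl. Qed.

Lemma cons_red_walk x d s : walk x (d :: s) ->
  walk x (cons_red d s) /\ wend x (cons_red d s) = wend x (d :: s).
Proof.
case: s => //= d' s /andP[/eqP xd /andP[/eqP dd' ws]].
case: eqP => [e|_] /=; last by rewrite xd dd' ws !eqxx.
by rewrite e dtgt_inv xd in ws; rewrite ws /wend /= e dtgt_inv xd.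
Qed.

Lemma red_walk x s : walk x s -> walk x (red s) /\ wend x (red s) = wend x s.
Proof.
elim: s x => //= d s IHs x /andP[xd /IHs[wr er]].
have /= := @cons_red_walk x d (red s); rewrite xd wr => -[//|wc ec].
by split=> //; rewrite ec; exact: er.
Qed.

Lemma rev_path_walk x s : walk x s ->
  walk (wend x s) (rev_path s) /\ wend (wend x s) (rev_path s) = x.
Proof.
elim: s x => //= d s IHs x /andP[/eqP <- /IHs[wr er]].
have -> : rev_path (d :: s) = rev_path s ++ [:: dinv d].
  by rewrite /rev_path /= rev_cons cats1.
rewrite walk_cat wend_cat; have -> : wend (dsrc d) (d :: s) = wend (dtgt d) s.
  by [].
by rewrite wr er /= dsrc_inv eqxx /wend /= dtgt_inv.
Qed.

End EdgePaths.

(* The universal cover, as the tree of reduced edge paths issued from x0. *)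
Section UniversalCover.
Variables (G : digraph) (x0 : vertex G).

Definition uvertex : Type := {s : seq (dart G) | walk x0 s && reduced s}.
HB.instance Definition _ := Choice.on uvertex.

Definition uend (p : uvertex) : vertex G := wend x0 (val p).

(* (p, e) is the lift of e starting at p. *)
Definition uedge : Type := {pe : uvertex * edge G | uend pe.1 == src pe.2}.
HB.instance Definition _ := Choice.on uedge.

Lemma uextend_proof (p : uvertex) (s : seq (dart G)) : walk (uend p) s ->
  walk x0 (red (val p ++ s)) && reduced (red (val p ++ s)).
Proof.
move=> ws; rewrite red_reduced andbT; have /andP[wp _] := valP p.
have w : walk x0 (val p ++ s) by rewrite walk_cat wp.
by have [] := red_walk w.
Qed.

Definition uextend (p : uvertex) (s : seq (dart G)) (ws : walk (uend p) s) :
  uvertex := Sub (red (val p ++ s)) (uextend_proof ws).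

Lemma usrc_walk (ue : uedge) : walk (uend (val ue).1) [:: ((val ue).2, true)].
Proof. by rewrite /= /dsrc /= (eqP (valP ue)) eqxx. Qed.

Definition usrc (ue : uedge) : uvertex := (val ue).1.
Definition utgt (ue : uedge) : uvertex := uextend (usrc_walk ue).

Definition ucover : digraph := @Digraph uvertex uedge usrc utgt.

Definition ubase : uvertex := Sub [::] isT.

Definition uproj (R : realType) (z : realization R ucover) : realization R G :=
  match z with
  | Vtx p => Vtx (uend p)
  | Inn ue t => Inn (val ue).2 t
  end.

Definition lift_edge (e : edge G) (p : uvertex) (pe : uend p = src e) : uedge :=
  Sub (p, e) (introT eqP pe).

End UniversalCover.

(* The edge path group: a homotopy class of loops at x0 is given by the unique
   reduced edge loop that it contains. *)
Section FundamentalGroup.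
Variables (G : digraph) (x0 : vertex G).

Definition pi1 : Type :=
  {s : seq (dart G) | [&& walk x0 s, reduced s & wend x0 s == x0]}.
HB.instance Definition _ := Choice.on pi1.

Lemma pi1_red_proof (s : seq (dart G)) : walk x0 s -> wend x0 s = x0 ->
  [&& walk x0 (red s), reduced (red s) & wend x0 (red s) == x0].
Proof.
by move=> ws es; have [-> ->] := red_walk ws; rewrite red_reduced es eqxx.
Qed.

Definition pi1_class (s : seq (dart G)) (ws : walk x0 s)
  (es : wend x0 s = x0) : pi1 := Sub (red s) (pi1_red_proof ws es).

Lemma pi1_walk (a : pi1) : walk x0 (val a).
Proof. by case/and3P: (valP a). Qed.

Lemma pi1_reduced (a : pi1) : reduced (val a).
Proof. by case/and3P: (valP a). Qed.

Lemma pi1_end (a : pi1) : wend x0 (val a) = x0.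
Proof. by case/and3P: (valP a) => _ _ /eqP. Qed.

Lemma pi1_mul_walk (a b : pi1) : walk x0 (val a ++ val b).
Proof. by rewrite walk_cat pi1_end !pi1_walk. Qed.

Lemma pi1_mul_end (a b : pi1) : wend x0 (val a ++ val b) = x0.
Proof. by rewrite wend_cat !pi1_end. Qed.

Lemma pi1_inv_walk (a : pi1) : walk x0 (rev_path (val a)).
Proof. by have [] := rev_path_walk (pi1_walk a); rewrite pi1_end. Qed.

Lemma pi1_inv_end (a : pi1) : wend x0 (rev_path (val a)) = x0.
Proof. by have [_] := rev_path_walk (pi1_walk a); rewrite pi1_end. Qed.

Definition pi1_one : pi1 := @pi1_class [::] isT erefl.
Definition pi1_mul (a b : pi1) : pi1 :=
  pi1_class (pi1_mul_walk a b) (pi1_mul_end a b).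
Definition pi1_inv (a : pi1) : pi1 :=
  pi1_class (pi1_inv_walk a) (pi1_inv_end a).

Lemma pi1_mulA : associative pi1_mul.
Proof. by move=> a b c; apply: val_inj; rewrite /= red_catl red_catr catA. Qed.

Lemma pi1_mul1 : left_id pi1_one pi1_mul.
Proof. by move=> a; apply: val_inj; rewrite /= red_id // pi1_reduced. Qed.

Lemma pi1_mulr1 : right_id pi1_one pi1_mul.
Proof. by move=> a; apply: val_inj; rewrite /= cats0 red_id // pi1_reduced. Qed.

Lemma pi1_mulV : left_inverse pi1_one pi1_inv pi1_mul.
Proof. by move=> a; apply: val_inj; rewrite /= red_catl red_rev_catl. Qed.

Lemma pi1_mulrV : right_inverse pi1_one pi1_inv pi1_mul.
Proof. by move=> a; apply: val_inj; rewrite /= red_catr red_rev_catr. Qed.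

HB.instance Definition _ :=
  isGroup.Build pi1 pi1_mulA pi1_mul1 pi1_mulr1 pi1_mulV pi1_mulrV.

Definition belongs (e : edge G) (a : pi1) : Prop :=
  forall t, cyclic_reduction (val a) t -> e \in map fst t.

(* The covering transformation of a; it sends the base point to the end of the
   lift of a issued from the base point. *)
Lemma udeck_proof (a : pi1) (p : uvertex x0) :
  walk x0 (red (val a ++ val p)) && reduced (red (val a ++ val p)).
Proof.
rewrite red_reduced andbT; have /andP[wp _] := valP p.
have w : walk x0 (val a ++ val p) by rewrite walk_cat pi1_end pi1_walk.
by have [] := red_walk w.
Qed.

Definition udeck_vertex (a : pi1) (p : uvertex x0) : uvertex x0 :=
  Sub (red (val a ++ val p)) (udeck_proof a p).

Lemma uend_deck (a : pi1) (p : uvertex x0) : uend (udeck_vertex a p) = uend p.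
Proof.
have /andP[wp _] := valP p.
have w : walk x0 (val a ++ val p) by rewrite walk_cat pi1_end pi1_walk.
by rewrite /uend /=; have [_ ->] := red_walk w; rewrite wend_cat pi1_end.
Qed.

Lemma udeck_edge_proof (a : pi1) (ue : uedge x0) :
  uend (udeck_vertex a (usrc ue)) = src (val ue).2.
Proof. by rewrite uend_deck; exact/eqP/(valP ue). Qed.

Definition udeck_edge (a : pi1) (ue : uedge x0) : uedge x0 :=
  lift_edge (udeck_edge_proof a ue).

Definition udeck (R : realType) (a : pi1) (z : realization R (ucover x0)) :
  realization R (ucover x0) :=
  match z with
  | Vtx p => Vtx (udeck_vertex a p : vertex (ucover x0))
  | Inn ue t => Inn (udeck_edge a ue : edge (ucover x0)) t
  end.

End FundamentalGroup.

Definition free_basis (P : groupType) (I : Type) (b : I -> P) : Prop :=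
  forall (H : groupType) (h : I -> H),
    exists2 phi : {multiplicative P -> H},
      (forall i, phi (b i) = h i) &
      forall psi : {multiplicative P -> H},
        (forall i, psi (b i) = h i) -> psi =1 phi.

Definition free_of_rank (P : groupType) (r : nat) : Prop :=
  exists b : 'I_r -> P, free_basis b.

Section CoherentLabeling.
Variables (G : finDigraph) (x0 : vertex G).

Definition spanning_tree (T : {set fedge G}) : Prop :=
  (forall x y : vertex G, exists s : seq (dart G),
     [/\ walk x s, wend x s = y & all (fun d => d.1 \in T) s]) /\
  (forall (x : vertex G) (s : seq (dart G)),
     walk x s -> wend x s = x -> reduced s -> all (fun d => d.1 \in T) s ->
     s = [::]).

Record coherent_labeling := CoherentLabeling {
  ctree : {set fedge G};
  ctreeP : spanning_tree ctree;
  clift : vertex G -> uvertex x0;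
  cliftK : forall x, uend (clift x) = x;
  clift_base : clift x0 = ubase x0;
  clift_tree : forall e : edge G, e \in ctree ->
    utgt (lift_edge (cliftK (src e))) = clift (tgt e) }.

(* For an edge of the tree as for any other edge, the chosen lift is the one
   starting at the chosen lift of the initial vertex. *)
Definition clift_edge (L : coherent_labeling) (e : edge G) : uedge x0 :=
  lift_edge (cliftK L (src e)).

Definition clift_point (R : realType) (L : coherent_labeling)
  (x : realization R G) : realization R (ucover x0) :=
  match x with
  | Vtx v => Vtx (clift L v : vertex (ucover x0))
  | Inn e t => Inn (clift_edge L e : edge (ucover x0)) t
  end.

End CoherentLabeling.

(* (w, n) stands for the formal power w^{1/n}, where n > 0; for a free group,
   w^{1/n} = v^{1/m} in its rational completion iff w^m = v^n. *)
Definition group_root (P : groupType) : Type := (P * nat)%type.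
Definition group_root_eq (P : groupType) (r s : group_root P) : Prop :=
  (r.1 ^+ s.2 = s.1 ^+ r.2)%g.

Section RotationElements.
Variables (R : realType) (G : finDigraph) (x0 : vertex G).
Variables (f : realization R G -> realization R G).
Variables (ft : realization R (ucover x0) -> realization R (ucover x0)).

Definition equivariant_lift : Prop :=
  [/\ continuous ft,
      forall z, uproj (ft z) = f (uproj z) &
      forall (a : pi1 x0) z, ft (udeck a z) = udeck a (ft z)].

(* r is the rotation element of x. *)
Definition rotation_element (L : coherent_labeling x0) (x : realization R G)
  (r : group_root (pi1 x0)) : Prop :=
  [/\ (0 < r.2)%N, iter r.2 f x = x &
      iter r.2 ft (clift_point L x) = udeck r.1 (clift_point L x)].

End RotationElements.

Definition periodic_point (X : Type) (f : X -> X) (x : X) : Prop :=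
  exists2 n, (0 < n)%N & iter n f x = x.

Definition forward_orbit (X : Type) (f : X -> X) (x : X) : set X :=
  [set iter k f x | k in [set: nat]].

(* Main.v *)
(* Write [f~] for the lift [ft] and [v] for the number of vertices. For a vertex p
   of the tree, f~^v(p) = a(p) p, where every a(p) is conjugate to w and
   a(g p) = g a(p) g^-1. If a were constant along edges it would be constant, w
   would be central, hence trivial. So some edge (p, q) has a := a(p) <> b := a(q).
   Then f~^(vk) maps this edge over the geodesic from a^k p to b^k q. A long
   subpath of that geodesic contains a long piece of the axis of a conjugate of w,
   hence many translates of the edge, and its length is unbounded in k: otherwise
   the pigeonhole principle would give a^m = b^m with m > 0, and a = b since roots
   are unique in a free group. Each translate g (p, q) crossed away from the ends of
   the geodesic gives, by the intermediate value theorem, an interior point of the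
   edge with rotation element g^(1/vk), and different g give different rotation
   elements. *)
Require Import Defs.
From HB Require Import structures.
From mathcomp Require Import all_boot all_order all_fingroup all_algebra.
From mathcomp Require Import all_classical all_reals all_analysis.
From mathcomp Require Import zify lra.
(* [dinv] is also a lemma of mathcomp-analysis. *)
Import Defs.

Set Implicit Arguments.
Unset Strict Implicit.
Unset Printing Implicit Defensive.

Import Order.TTheory GRing.Theory Num.Theory.
Import numFieldNormedType.Exports.

Local Open Scope classical_set_scope.

(** * Syndetic words and cancellation *)

Section Sequences.
Variable T : Type.
Implicit Types (s t c : seq T) (e : T -> T -> bool) (P : pred T) (m n : nat).

Lemma sorted_cat3 e s t r : (0 < size t)%N ->
  sorted e (s ++ t) -> sorted e (t ++ r) -> sorted e (s ++ t ++ r).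
Proof.
case: t => // x t _; case: s => [//|y s] /=.
by rewrite !cat_path /= !cat_path => /and3P[-> -> _].
Qed.

Fixpoint wpow c n : seq T := if n is n'.+1 then c ++ wpow c n' else [::].

Lemma wpow1 c : wpow c 1 = c.
Proof. by rewrite /= cats0. Qed.

Lemma wpowS c n : wpow c n.+1 = c ++ wpow c n.
Proof. by []. Qed.

Lemma wpowD c m n : wpow c (m + n) = wpow c m ++ wpow c n.
Proof. by elim: m => //= m IHm; rewrite -catA -IHm. Qed.

Lemma size_wpow c n : size (wpow c n) = (n * size c)%N.
Proof. by elim: n => // n IHn; rewrite wpowS size_cat IHn mulSn. Qed.

Lemma sorted_wpow e c n : sorted e (c ++ c) -> sorted e (wpow c n).
Proof.
case: c => [|x c] hc; first by elim: n.
elim: n => [//|[|n] IHn].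
  by move: hc; rewrite /= cats0 cat_path => /andP[].
by rewrite wpowS wpowS; apply: sorted_cat3 => //; rewrite -wpowS.
Qed.

Lemma wpow_inj c c' n : (0 < n)%N -> wpow c n = wpow c' n -> c = c'.
Proof.
case: n => // n _ e; have := congr1 size e.
rewrite !size_wpow => /eqP; rewrite eqn_pmul2l // => /eqP es.
by have := congr1 (take (size c)) e; rewrite !wpowS take_size_cat // take_size_cat.
Qed.

(** Letters satisfying [P] recur with gaps bounded in terms of [M]. Quantifying over all factors
    makes the property pass to subwords; the successor allows for factors without such a letter. *)
Definition syndetic P M s : Prop := forall m n,
  (size (take n (drop m s)) <= (count P (take n (drop m s))).+1 * M)%N.

(** For the conjugating words, about whose letters nothing is known: only their lengths enter the
    bound. *)
Lemma syndetic_size P s : syndetic P (size s) s.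
Proof.
move=> m n; rewrite mulSn; apply: leq_trans (leq_addr _ _).
by rewrite size_take_min size_drop; lia.
Qed.

Lemma drop_catE m s t : drop m (s ++ t) = drop m s ++ drop (m - size s) t.
Proof.
rewrite drop_cat; case: ltnP => [h|h]; last by rewrite (drop_oversize h).
have -> : (m - size s = 0)%N by lia.
by rewrite drop0.
Qed.

Lemma take_catE m s t : take m (s ++ t) = take m s ++ take (m - size s) t.
Proof.
rewrite take_cat; case: ltnP => [h|h]; last by rewrite (take_oversize h).
have -> : (m - size s = 0)%N by lia.
by rewrite take0 cats0.
Qed.

Lemma syndetic_cat P M N s t :
  syndetic P M s -> syndetic P N t -> syndetic P (M + N) (s ++ t).
Proof.
move=> hs ht m n; rewrite drop_catE take_catE size_cat count_cat.
have := hs m n; have := ht (m - size s)%N (n - size (drop m s))%N.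
nia.
Qed.

Lemma syndetic_take P M j s : syndetic P M s -> syndetic P M (take j s).
Proof.
move=> hs m n; have [jm|mj] := leqP j m.
  by rewrite drop_oversize // size_take_min; lia.
have -> : drop m (take j s) = take (j - m) (drop m s).
  by rewrite take_drop; congr (drop _ (take _ _)); lia.
by rewrite -take_min; exact: hs.
Qed.

Lemma syndetic_drop P M j s : syndetic P M s -> syndetic P M (drop j s).
Proof. by move=> hs m n; rewrite drop_drop; exact: hs. Qed.

Lemma size_take_wpow P c n k : has P c ->
  (size (take n (wpow c k)) <= (count P (take n (wpow c k))).+1 * size c)%N.
Proof.
rewrite has_count => hc; elim: k n => [//|k IHk] n.
rewrite wpowS take_catE size_cat count_cat.
have [nc|cn] := leqP n (size c).
  have -> : (n - size c = 0)%N by lia.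
  by rewrite take0 /= addn0 mulSn size_take_min; lia.
have := IHk (n - size c)%N; rewrite (take_oversize (ltnW cn)) => IH.
by rewrite -addnS mulnDl leq_add // leq_pmull.
Qed.

(** A factor of a power is a factor of one copy of [c] followed by a prefix of a power. Each part
    costs one [size c], so the constant is independent of [k]. *)
Lemma syndetic_wpow P c k : has P c -> syndetic P (size c).*2 (wpow c k).
Proof.
move=> hc; elim: k => [//|k IHk] m n.
rewrite wpowS drop_catE take_catE size_cat count_cat.
have [cm|mc] := leqP (size c) m; first by rewrite (drop_oversize cm); exact: IHk.
have -> : (m - size c = 0)%N by lia.
rewrite drop0; have := size_take_wpow (n - size (drop m c)) k hc.
have : (size (take n (drop m c)) <= size c)%N.
  by rewrite size_take_min size_drop; lia.
nia.
Qed.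

End Sequences.

Arguments wpow : simpl never.

(** * Reduced words and free cancellation *)

Section ReducedWords.
Variable G : digraph.
Implicit Types (s t u c : seq (dart G)) (d : dart G).

Lemma rev_path_cat s t : rev_path (s ++ t) = rev_path t ++ rev_path s.
Proof. by rewrite /rev_path map_cat rev_cat. Qed.

Lemma rev_path_cons d s : rev_path (d :: s) = rev_path s ++ [:: dinv d].
Proof. by rewrite /rev_path /= rev_cons cats1. Qed.

Lemma rev_path_rcons s d : rev_path (rcons s d) = dinv d :: rev_path s.
Proof. by rewrite -cats1 rev_path_cat. Qed.

Lemma reduced_rev s : reduced (rev_path s) = reduced s.
Proof.
rewrite /reduced /rev_path rev_sorted sorted_map.
apply: eq_sorted => d d'; rewrite /= /no_backtrack (eqtype.inv_eq (@dinvK G)).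
by rewrite dinvK eq_sym (eqtype.inv_eq (@dinvK G)).
Qed.

Lemma reduced_cat s t : reduced (s ++ t) -> reduced s /\ reduced t.
Proof. by move/cat_sorted2; case. Qed.

Lemma red_catlr s t r : red (s ++ red t ++ r) = red (s ++ t ++ r).
Proof. by rewrite -[LHS]red_catr red_catl red_catr. Qed.

Lemma red_rev s : red (rev_path s) = rev_path (red s).
Proof.
have hr : reduced (rev_path (red s)) by rewrite reduced_rev red_reduced.
rewrite -(red_id hr) -[RHS]/(red ([::] ++ _)) -(red_rev_catl s) red_catl -catA.
rewrite -[RHS]red_catr -(red_catl s) red_rev_catr.
by rewrite cats0.
Qed.

Lemma red_cancell s t : red (rev_path s ++ s ++ t) = red t.
Proof. by rewrite catA -red_catl red_rev_catl. Qed.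

Lemma red_cancelr s t : red (s ++ rev_path s ++ t) = red t.
Proof. by rewrite -{1}(rev_pathK s) red_cancell. Qed.

Lemma red_cancel_mid s u t : red (s ++ rev_path u ++ u ++ t) = red (s ++ t).
Proof. by rewrite -red_catr red_cancell red_catr. Qed.

(** Cancellation removes only a suffix of [s] and a prefix of [t]; this lets syndeticity pass to
    products. *)
Lemma red_cat_split s t : reduced s -> reduced t ->
  exists i j, red (s ++ t) = take i s ++ drop j t.
Proof.
move=> hs ht; rewrite red_cat (red_id ht).
elim: s hs => [_|d s IHs hs]; first by exists 0%N, 0%N; rewrite drop0.
have [i [j /= ->]] := IHs (path_sorted hs).
case Es: (take i s) => [|d1 s1] /=; last first.
  (* While a letter of [s] survives, [d] cannot cancel, because [d :: s] is reduced. *)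
  exists i.+1, j; rewrite /= Es /=; case: s Es hs {IHs} => [|d2 s]; case: i => //= i.
  by move=> [-> _] /andP[/negbTE ->].
case Et: (drop j t) => [|d2 r] /=.
  by exists 1%N, (size t); rewrite /= take0 drop_size.
case: eqP => _; last by exists 1%N, j; rewrite /= take0 Et.
by exists 0%N, j.+1; rewrite /= -addn1 addnC -drop_drop Et /= drop0.
Qed.

End ReducedWords.

(** * Unique roots and the centre *)

Section CyclicReduction.
Variable G : digraph.
Implicit Types (s t u c : seq (dart G)) (d : dart G).

Lemma dinv_neq d : d != dinv d.
Proof. by apply/eqP; case: d => e []. Qed.

Lemma cyc_reducedE c : cyc_reduced c = reduced (c ++ c).
Proof.
case: c => //= d c; rewrite /cyc_reduced /reduced /= rcons_path cat_path /=.
by case: (path _ _ _); rewrite ?andbF ?andbT.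
Qed.

Lemma cyc_reduced_reduced c : cyc_reduced c -> reduced c.
Proof. by rewrite cyc_reducedE => /reduced_cat[]. Qed.

Lemma cyc_reduced_rev c : cyc_reduced (rev_path c) = cyc_reduced c.
Proof. by rewrite !cyc_reducedE -rev_path_cat reduced_rev. Qed.

Lemma cyc_reduced_wpow c n : cyc_reduced c -> cyc_reduced (wpow c n).
Proof. by rewrite !cyc_reducedE -wpowD; exact: sorted_wpow. Qed.

(** As long as the first and last letters are mutually inverse, they are moved into the conjugating
    word. *)
Lemma cyclic_decomposition s : reduced s ->
  exists u c, s = u ++ c ++ rev_path u /\ cyc_reduced c.
Proof.
have [n] := ubnP (size s); elim: n s => // n IHn s sn hs.
have [cs|ncs] := boolP (cyc_reduced s); first by exists [::], s; rewrite cats0.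
case: s sn hs ncs => // d s; case/lastP: s => [|s d'] sn hs.
  by rewrite /cyc_reduced /= /no_backtrack dinv_neq.
rewrite /cyc_reduced /= rcons_path last_rcons.
move: (hs); rewrite /reduced /= => -> /=; rewrite negbK => /eqP dd'.
have hs' : reduced s.
  by move: hs; rewrite -cats1 -(cat1s d) => /reduced_cat[_] /reduced_cat[].
have [|u [c [-> hc]]] := IHn s _ hs'; first by move: sn; rewrite /= size_rcons; lia.
exists (d :: u), c; split => //.
by rewrite rev_path_cons dd' dinvK -cats1 /= -!catA.
Qed.

(** A nonempty conjugating word makes the first and last letters mutually inverse, which a
    cyclically reduced word excludes; so both sides are peeled in step. *)
Lemma cyclic_decomposition_uniq u c u' c' : cyc_reduced c -> cyc_reduced c' ->
  u ++ c ++ rev_path u = u' ++ c' ++ rev_path u' -> u = u' /\ c = c'.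
Proof.
have aux d v c1 : cyc_reduced ((d :: v) ++ c1 ++ rev_path (d :: v)) = false.
  rewrite rev_path_cons !catA cats1 /cyc_reduced /= rcons_path last_rcons.
  by rewrite /no_backtrack dinvK eqxx andbF.
move=> hc hc'; elim: u u' => [|d u IHu] [|d' u'].
- by rewrite /= !cats0.
- by move=> e; move: hc; rewrite -[c]cats0 -[_ ++ _]/([::] ++ c ++ rev_path [::]) e aux.
- by move=> e; move: hc'; rewrite -[c']cats0 -[_ ++ _]/([::] ++ c' ++ rev_path [::]) -e aux.
rewrite !rev_path_cons /= !catA !cats1 => -[<-] /rcons_inj[]; rewrite -!catA.
by move=> /IHu[-> ->].
Qed.

(** Being reduced is a condition on adjacent letters, and for nonempty [c] each adjacent pair
    already occurs in [u ++ c ++ rev_path u] or in [c ++ c]. The exponent is positive because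
    [u ++ rev_path u] is not reduced for nonempty [u]. *)
Lemma reduced_conj_wpow u c n : cyc_reduced c -> reduced (u ++ c ++ rev_path u) ->
  reduced (u ++ wpow c n.+1 ++ rev_path u).
Proof.
move=> hc h; have [c0|c0] := posnP (size c).
  case: c c0 hc h => // _ _; have -> // : wpow [::] n.+1 = [::] :> seq (dart G).
  by elim: n => // n IHn; rewrite wpowS IHn.
have hcc : reduced (wpow c n ++ c).
  by rewrite -[X in _ ++ X]wpow1 -wpowD; apply: sorted_wpow; move: hc; rewrite cyc_reducedE.
have -> : wpow c n.+1 = wpow c n ++ c by rewrite -addn1 wpowD wpow1.
rewrite -catA catA.
apply: sorted_cat3 => //; last by case/reduced_cat: h.
have : reduced (u ++ c) by move: h; rewrite catA => /reduced_cat[].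
case: n hcc => [|n] hcc h1; first by rewrite /= cats0.
rewrite -catA -[wpow c n.+1 ++ c]/(wpow c n.+1 ++ c) wpowS -catA.
by apply: sorted_cat3 => //; rewrite catA -wpowS.
Qed.

Lemma red_wpow_conj u c n :
  red (wpow (u ++ c ++ rev_path u) n) = red (u ++ wpow c n ++ rev_path u).
Proof.
elim: n => [|n IHn]; first by rewrite /= red_rev_catr.
rewrite wpowS -red_catr IHn red_catr -!catA (catA u c) red_cancel_mid -catA.
by [].
Qed.

(** Rotating the word brings [rev_path u] in front of [u], and the pairs cancel from the middle
    outwards. *)
Lemma contracts_cyclic u c : contracts (u ++ c ++ rev_path u) c.
Proof.
apply: contracts_base; rewrite -catA; elim: u => [|d u IHu].
  by rewrite /= cats0; exact: contracts_refl.
rewrite rev_path_cons -catA catA -[[:: _] ++ _]/([:: dinv d; d] ++ u).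
have := contracts_cancel (dinv d) (_ : contracts ((c ++ rev_path u) ++ u) c).
by rewrite dinvK; apply; rewrite -catA.
Qed.

End CyclicReduction.

Section EdgePathGroup.
Variables (G : digraph) (x0 : vertex G).
Implicit Types (a b : pi1 x0) (s : seq (dart G)).

Lemma val_mulg a b : val (a * b)%g = red (val a ++ val b).
Proof. by []. Qed.

Lemma val_invg a : val (a^-1)%g = rev_path (val a).
Proof. by rewrite /= red_id // reduced_rev pi1_reduced. Qed.

Lemma val_one : val (1%g : pi1 x0) = [::].
Proof. by []. Qed.

Lemma val_expg a n : val (a ^+ n)%g = red (wpow (val a) n).
Proof.
by elim: n => [//|n IHn]; rewrite expgS val_mulg IHn red_catr.
Qed.

(** Written as [u c^n u^-1] with [c] cyclically reduced, a power determines [u] and [c^n], and [c^n]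
    determines [c]. *)
Lemma pi1_root_uniq a b n : (0 < n)%N -> (a ^+ n = b ^+ n)%g -> a = b.
Proof.
case: n => // n _ /(congr1 val); rewrite !val_expg.
have ha := pi1_reduced a; have hb := pi1_reduced b.
have [u [c [ea hc]]] := cyclic_decomposition ha.
have [v [d [eb hd]]] := cyclic_decomposition hb.
rewrite ea in ha; rewrite eb in hb.
rewrite ea eb !red_wpow_conj !red_id ?reduced_conj_wpow // => e.
have [uv /wpow_inj cd] :=
  cyclic_decomposition_uniq (cyc_reduced_wpow _ hc) (cyc_reduced_wpow _ hd) e.
by apply: val_inj; rewrite ea eb uv cd //.
Qed.

Lemma belongs_cyclic_decomposition a : exists u c,
  [/\ val a = u ++ c ++ rev_path u, cyc_reduced c &
      forall e, belongs e a -> has (fun d => d.1 == e) c].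
Proof.
have [u [c [ea hc]]] := cyclic_decomposition (pi1_reduced a).
exists u, c; split=> // e e_a; have /mapP[d dc ->] : e \in map fst c.
  by apply: e_a; split=> //; rewrite ea; exact: contracts_cyclic.
by apply/hasP; exists d.
Qed.

End EdgePathGroup.

(** * Free groups of rank at least 2 have trivial centre *)

Section FreeCenter.
Variables (P : groupType) (r : nat) (b : 'I_r -> P).

(* The edge path group of a bouquet is the concrete free group. *)
Definition bouquet : digraph := @Digraph unit 'I_r (fun=> tt) (fun=> tt).

Definition bpt : vertex bouquet := tt.

Lemma bouquet_walk (s : seq (dart bouquet)) x : walk x s.
Proof. by elim: s x => //= d s IHs []; rewrite IHs andbT; case: (dsrc d). Qed.

Lemma bouquet_proof s :
  [&& walk bpt (red s), reduced (red s) & wend bpt (red s) == bpt].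
Proof. by rewrite bouquet_walk red_reduced; case: (wend _ _). Qed.

Definition bword s : pi1 bpt := Sub (red s) (bouquet_proof s).

Definition bletter (i : 'I_r) : dart bouquet := (i, true).

Fixpoint beval (s : seq (dart bouquet)) : P :=
  if s is d :: s' then ((if d.2 then b d.1 else (b d.1)^-1) * beval s')%g else 1%g.

Lemma beval_red s : beval (red s) = beval s.
Proof.
elim: s => //= d s <-; case: (red s) => //= d' t; case: eqP => //= ->.
by case: d => i [] /=; rewrite ?mulKg ?mulKVg.
Qed.

Lemma beval_cat s t : beval (s ++ t) = (beval s * beval t)%g.
Proof. by elim: s => [|d s IHs] /=; rewrite ?mul1g // IHs mulgA. Qed.

Definition bevalpi1 (a : pi1 bpt) : P := beval (val a).

Lemma bevalpi1M : {morph bevalpi1 : x y / (x * y)%g}.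
Proof. by move=> x y; rewrite /bevalpi1 val_mulg beval_red beval_cat. Qed.

HB.instance Definition _ := isMultiplicative.Build (pi1 bpt) P bevalpi1 bevalpi1M.

(** The universal property sends each generator to a loop of the bouquet. Evaluation of words is a
    left inverse, by the uniqueness clause for maps from [P] to itself. *)
Lemma free_embedding : free_basis b ->
  exists phi : P -> pi1 bpt,
    [/\ phi 1%g = 1%g, {morph phi : x y / (x * y)%g}, injective phi &
        forall i, val (phi (b i)) = [:: bletter i]].
Proof.
move=> hb; have [phi hphi _] := hb _ (fun i => bword [:: bletter i]).
exists phi; split=> [|||i]; last by rewrite hphi.
- by apply: (mulgI (phi 1%g)); rewrite -gmulfM !mulg1.
- exact: gmulfM.
apply: (can_inj (g := bevalpi1)) => x.
have [theta _ uniq] := hb _ b.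
rewrite -[LHS]/((bevalpi1 \o phi) x) (uniq (bevalpi1 \o phi)); last first.
  by move=> i /=; rewrite hphi /bevalpi1 /= mulg1.
by have := uniq (@idfun P : {multiplicative P -> P}) (fun=> erefl) x.
Qed.

(** If the word of [z] starts with [d], take a generator of another index. Multiplying by it on the
    left gives a word one letter longer that starts with this generator; a product on the right of
    that length still starts with [d]. *)
Lemma free_center (z : P) : (2 <= r)%N -> free_basis b ->
  (forall x, (z * x = x * z)%g) -> z = 1%g.
Proof.
move=> r2 /free_embedding[phi [phi1 phiM phi_inj hphi]] zC.
apply: phi_inj; rewrite phi1; apply: val_inj; rewrite val_one.
case E: (val (phi z)) => [//|d s].
have [i id1] : exists i : 'I_r, i != d.1.
  pose i0 : 'I_r := Ordinal (ltnW r2); pose i1 : 'I_r := Ordinal r2.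
  have [e|] := eqVneq i0 d.1; last by exists i0.
  by exists i1; rewrite -e.
have := congr1 (fun x => val (phi x)) (zC (b i)).
rewrite /= !phiM !val_mulg hphi E => e.
have hds : reduced (d :: s) by rewrite -E pi1_reduced.
have e1 : red ([:: bletter i] ++ d :: s) = bletter i :: d :: s.
  rewrite red_id // /reduced /=; apply/andP; split; last exact: hds.
  by apply: contraNneq id1 => ->.
have [k [j e2]] := red_cat_split hds (isT : reduced [:: bletter i]).
have : (size (take k (d :: s) ++ drop j [:: bletter i]) = (size s).+2)%N.
  by rewrite -e2 e e1.
rewrite size_cat size_take_min size_drop /= => sz.
case: k e2 sz => [|k] e2 sz; first by lia.
move: e2; rewrite e e1 /= => -[di _].
by move: id1; rewrite -di eqxx.
Qed.

Lemma free_nontrivial : (0 < r)%N -> free_basis b -> exists z : P, z != 1%g.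
Proof.
move=> r0 /free_embedding[phi [phi1 _ _ hphi]]; exists (b (Ordinal r0)).
apply/eqP => e; have := hphi (Ordinal r0).
by rewrite e phi1 val_one.
Qed.

End FreeCenter.

(** * The universal cover *)

Section Tree.
Variables (G : digraph) (x0 : vertex G).
Implicit Types (s t : seq (dart G)) (d : dart G) (p q : uvertex x0).
Implicit Types (a b : pi1 x0) (ue : uedge x0).

Lemma red_catIr s s' t : red (s ++ t) = red (s' ++ t) -> red s = red s'.
Proof.
move=> e; rewrite -[s]cats0 -[s']cats0 -!(red_catr _ [::]) -(red_rev_catr t).
by rewrite !red_catr !catA -!(red_catl (_ ++ t)) e.
Qed.

Lemma red_catIl s t t' : red (s ++ t) = red (s ++ t') -> red t = red t'.
Proof. by move=> e; rewrite -(red_cancell s t) -red_catr e red_catr red_cancell. Qed.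

Lemma red_rcons s d : reduced s -> red (rcons s d) = rcons s d \/
  exists2 s', s = rcons s' (dinv d) & red (rcons s d) = s'.
Proof.
case/lastP: s => [|s d'] hs; first by left.
have [ed|nd] := eqVneq d' (dinv d).
  right; exists s; rewrite ed // -cats1 -cats1 -catA -[LHS]red_catr /= dinvK eqxx.
  by rewrite cats0 red_id //; move: hs; rewrite -cats1 => /reduced_cat[].
left; rewrite red_id // -[rcons s d']cats1 -cats1 -catA.
apply: sorted_cat3 => //; first by rewrite cats1.
rewrite /= andbT /no_backtrack; apply: contraNneq nd => ->.
by rewrite dinvK.
Qed.

Lemma uvertex_walk p : walk x0 (val p).
Proof. by case/andP: (valP p). Qed.

Lemma uvertex_reduced p : reduced (val p).
Proof. by case/andP: (valP p). Qed.

(** The geodesic of the tree from [p] to [q], as the word of darts of [G] to which it projects. *)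
Definition upath p q : seq (dart G) := red (rev_path (val p) ++ val q).

Lemma upath_reduced p q : reduced (upath p q).
Proof. exact: red_reduced. Qed.

Lemma upath_walk p q :
  walk (uend p) (upath p q) /\ wend (uend p) (upath p q) = uend q.
Proof.
have [wp ep] := rev_path_walk (uvertex_walk p).
have w : walk (uend p) (rev_path (val p) ++ val q).
  by rewrite walk_cat wp /uend ep uvertex_walk.
by have [-> ->] := red_walk w; rewrite wend_cat /uend ep.
Qed.

Lemma upath_rev p q : rev_path (upath p q) = upath q p.
Proof. by rewrite -red_rev rev_path_cat rev_pathK. Qed.

Lemma red_upath p q s : red (upath p q ++ s) = red (rev_path (val p) ++ val q ++ s).
Proof. by rewrite red_catl catA. Qed.

Lemma upath_nil p q : upath p q = [::] -> p = q.
Proof.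
move=> e; apply: val_inj.
rewrite -(red_id (uvertex_reduced p)) -(red_id (uvertex_reduced q)).
rewrite -[RHS](red_cancelr (val p)) -[in RHS]red_catr -/(upath p q) e.
by rewrite cats0.
Qed.

Lemma upath_utgt p ue :
  upath p (utgt ue) = red (rcons (upath p (usrc ue)) ((val ue).2, true)).
Proof. by rewrite -cats1 red_upath /upath /= red_catr. Qed.

Lemma upath_uextend p q (s : seq (dart G)) (ws : walk (uend q) s) :
  upath p (uextend ws) = red (upath p q ++ s).
Proof. by rewrite red_upath /upath /= red_catr. Qed.

Lemma udeck_vertexM a b p :
  udeck_vertex (a * b)%g p = udeck_vertex a (udeck_vertex b p).
Proof. by apply: val_inj; rewrite /= red_catl red_catr catA. Qed.

Lemma udeck_vertex1 p : udeck_vertex 1%g p = p.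
Proof. by apply: val_inj; rewrite /= red_id // uvertex_reduced. Qed.

Lemma udeck_vertex_free a b p : udeck_vertex a p = udeck_vertex b p -> a = b.
Proof.
move=> /(congr1 val) /= /red_catIr; rewrite !red_id ?pi1_reduced // => e.
exact: val_inj.
Qed.

Lemma udeck_vertex_trans p q : uend p = uend q -> exists a, q = udeck_vertex a p.
Proof.
move=> e; have [wp ep] := rev_path_walk (uvertex_walk p).
have ws : walk x0 (val q ++ rev_path (val p)).
  by rewrite walk_cat uvertex_walk -/(uend q) -e.
have es : wend x0 (val q ++ rev_path (val p)) = x0.
  by rewrite wend_cat -/(uend q) -e.
exists (pi1_class ws es); apply: val_inj.
rewrite /= red_catl -catA -red_catr red_rev_catl cats0.
by rewrite red_id ?uvertex_reduced.
Qed.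

Lemma uedge_inj ue ue' : usrc ue = usrc ue' -> (val ue).2 = (val ue').2 -> ue = ue'.
Proof.
case: ue ue' => [[p e] h] [[p' e'] h'] /= => ep ee; apply: val_inj => /=.
by rewrite -[p]/(usrc (exist _ (p, e) h)) ep ee.
Qed.

Lemma udeck_edgeM a b ue : udeck_edge (a * b)%g ue = udeck_edge a (udeck_edge b ue).
Proof. by apply: uedge_inj => //; exact: udeck_vertexM. Qed.

Lemma utgt_deck a ue : utgt (udeck_edge a ue) = udeck_vertex a (utgt ue).
Proof. by apply: val_inj; rewrite /= red_catl red_catr catA. Qed.

(** * Heights that separate the two sides of an edge of the tree *)

Section Height.
Local Open Scope ring_scope.
Variable R : realType.

(* A truncated signed height above the initial vertex of the edge ue, whose end
   points have heights 0 and 1; ue is the only edge that crosses ]0, 1[. *)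
Definition word_height d0 s : R :=
  if s is d :: s' then
    if d == d0 then (if s' is [::] then 1 else 2) else -1
  else 0.

Definition uheight ue p : R := word_height ((val ue).2, true) (upath (usrc ue) p).

Lemma word_height_head d0 d s :
  word_height d0 (d :: s) = -1 /\ d != d0 \/ 1 <= word_height d0 (d :: s) /\ d = d0.
Proof.
rewrite /=; case: eqP => [->|_]; last by left.
by right; case: s => [|*]; split => //; lra.
Qed.

Lemma word_height_cases d0 s : word_height d0 s <= 0 \/ 1 <= word_height d0 s.
Proof.
case: s => [|d s]; first by left.
by case: (word_height_head d0 d s) => -[h _]; [left; rewrite h; lra|right].
Qed.

Lemma uheight_src ue : uheight ue (usrc ue) = 0.
Proof. by rewrite /uheight /upath red_rev_catl. Qed.

Lemma uheight_tgt ue : uheight ue (utgt ue) = 1.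
Proof. by rewrite /uheight upath_utgt /upath red_rev_catl /= eqxx. Qed.

(** The height is governed by the first letter of a geodesic. Following [ue'] changes that letter
    only if the geodesic is empty before or after, and then both heights are at most 0. *)
Lemma uheight_edge ue ue' : ue' <> ue ->
  uheight ue (usrc ue') <= 0 /\ uheight ue (utgt ue') <= 0 \/
  1 <= uheight ue (usrc ue') /\ 1 <= uheight ue (utgt ue').
Proof.
move=> ne; rewrite /uheight upath_utgt; move: (upath_reduced (usrc ue) (usrc ue')).
have : upath (usrc ue) (usrc ue') = [::] -> (val ue').2 <> (val ue).2.
  by move=> /upath_nil e1 e2; apply: ne; exact: uedge_inj.
move: (upath _ _) => x nx hx; set d0 := (_, true); set d' := (_, true).
have aux d s s' : word_height d0 (d :: s) <= 0 /\ word_height d0 (d :: s') <= 0 \/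
    1 <= word_height d0 (d :: s) /\ 1 <= word_height d0 (d :: s').
  have := word_height_head d0 d s; have := word_height_head d0 d s'.
  case=> -[-> h1]; case=> -[h2 h3]; rewrite ?h2; [left|exfalso|exfalso|by right].
  - by split; lra.
  - by rewrite h3 eqxx in h1.
  - by rewrite h1 eqxx in h3.
have [->|[y ex ->]] := red_rcons d' hx.
  case: x nx hx => [|d x] nx hx /=; last exact: aux.
  left; split => //; case: eqP => [e|_]; last by lra.
  by case: (nx erefl); case: e.
case: y ex => [|d y] ->; last exact: aux.
by left; rewrite /=; case: eqP => // _; split; lra.
Qed.

(** [m] is the vertex at which the geodesic is cut after [t]. *)
Lemma upath_split p q t r : upath p q = t ++ r ->
  exists m, [/\ upath p m = t, upath m p = rev_path t, upath m q = r &
                uend m = wend (uend p) t].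
Proof.
move=> e; have [wpq _] := upath_walk p q.
have wt : walk (uend p) t by move: wpq; rewrite e walk_cat => /andP[].
have [rt rr] : reduced t /\ reduced r.
  by apply: reduced_cat; rewrite -e upath_reduced.
have pm : upath p (uextend wt) = t.
  by rewrite upath_uextend /upath red_rev_catl /= red_id.
exists (uextend wt); split=> //.
- by rewrite -upath_rev pm.
- rewrite -[RHS](red_id rr) -[RHS](red_cancell t) -e -[in RHS]pm upath_rev.
  by rewrite /upath red_catl red_catr -catA -[RHS]red_catr red_cancelr red_catr.
- by have [_ <-] := upath_walk p (uextend wt); rewrite pm.
Qed.

(** Letters on both sides of the crossing put [p] and [q] beyond the ends of [ue]. For a forward
    crossing this gives the strict inequalities that exclude a fixed point at an end. A backward
    crossing reaches the initial vertex of [ue] only after its letter, hence the [rcons]. *)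
Lemma uheight_crossing p q s1 e (b : bool) s2 : upath p q = s1 ++ (e, b) :: s2 ->
  (0 < size s1)%N -> (0 < size s2)%N ->
  exists ue : uedge x0,
    [/\ (val ue).2 = e,
        upath p (usrc ue) = (if b then s1 else rcons s1 (e, b)) &
        uheight ue p < 0 /\ 1 < uheight ue q \/
        1 <= uheight ue p /\ uheight ue q <= 0].
Proof.
move=> eqs; have hr := upath_reduced p q; have [wpq _] := upath_walk p q.
rewrite eqs in hr wpq; case: b eqs hr wpq => eqs hr wpq n1 n2.
  have [m [pm mp mq em]] := upath_split eqs.
  have et : uend m = src e.
    by rewrite em; move: wpq; rewrite walk_cat /= => /and3P[_ /eqP <- _].
  exists (lift_edge et); split=> //; left; rewrite /uheight mp mq /= eqxx.
  split; last by case: (s2) n2 => // *; lra.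
  case/lastP: s1 n1 eqs hr {wpq pm mp em} => // s1 d _ _ hr; rewrite rev_path_rcons /=.
  move: hr; rewrite cat_rcons => /reduced_cat[_] /= /andP[].
  by rewrite /no_backtrack eq_sym => /negbTE -> _; lra.
rewrite -cat_rcons in eqs; have [m [pm mp mq em]] := upath_split eqs.
have et : uend m = src e by rewrite em -cats1 wend_cat.
exists (lift_edge et); split=> //; right; rewrite /uheight mp mq /= rev_path_rcons.
split; last first.
  move: hr => /reduced_cat[_]; case: (s2) n2 => //= d s3 _ /andP[].
  by rewrite /no_backtrack => /negbTE -> _; lra.
by rewrite /= eqxx; case: (rev_path _) => *; lra.
Qed.

End Height.
End Tree.

(** * Fixed points on edges *)

Section Realizations.
Variables (R : realType) (G : digraph).
Local Open Scope ring_scope.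

Lemma charmap_continuous (e : edge G) : continuous (@charmap R G e).
Proof. by apply/continuousP => A oA; exact: oA. Qed.

Lemma realization_continuous (T : topologicalType) (g : realization R G -> T) :
  (forall e, continuous (g \o charmap e)) -> continuous g.
Proof.
move=> hg; apply/continuousP => A oA; rewrite -[open _]/(cw_open _) => e.
by have /continuousP/(_ A oA) := hg e.
Qed.

Lemma charmap_inside (e : edge G) (t : {t : R | 0 < t < 1}) : charmap e (val t) = Inn e t.
Proof.
rewrite /charmap; have /andP[t0 t1] := valP t.
by rewrite leNgt t0 /= valK.
Qed.

Lemma charmap0 (e : edge G) : charmap e (0 : R) = Vtx (src e).
Proof. by rewrite /charmap lexx. Qed.

Lemma charmap1 (e : edge G) : charmap e (1 : R) = Vtx (tgt e).
Proof.
rewrite /charmap leNgt ltr01 /=; case: insubP => // u; rewrite ltxx andbF //.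
Qed.

Definition interpolate (h : vertex G -> R) (z : realization R G) : R :=
  match z with
  | Vtx v => h v
  | Inn e t => h (src e) + val t * (h (tgt e) - h (src e))
  end.

Lemma interpolate_charmap h e (t : R) :
  interpolate h (charmap e t) =
  h (src e) + Num.min 1 (Num.max 0 t) * (h (tgt e) - h (src e)).
Proof.
have [t0|t0] := leP t 0.
  by rewrite /charmap t0 /= (min_r ler01) mul0r addr0.
have [t1|t1] := leP 1 t; last first.
  have ht : 0 < t < 1 by rewrite t0 t1.
  by rewrite -[t in charmap _ t]/(val (exist _ t ht : {t : R | 0 < t < 1})) charmap_inside.
rewrite /charmap leNgt t0 /=; case: insubP => [u /andP[_]|_] /=; last by lra.
by rewrite ltNge t1.
Qed.

Lemma interpolate_continuous h : continuous (interpolate h).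
Proof.
apply: realization_continuous => e.
have -> : interpolate h \o charmap e = fun t : R =>
    h (src e) + Num.min 1 (Num.max 0 t) * (h (tgt e) - h (src e)).
  by apply/funext => t; exact: interpolate_charmap.
move=> t; apply: cvgD; first exact: cvg_cst.
apply: cvgMl; apply: continuous_min; first exact: cvg_cst.
by apply: continuous_max; [exact: cvg_cst|exact: cvg_id].
Qed.

End Realizations.

Section Cover.
Variables (R : realType) (G : digraph) (x0 : vertex G).
Local Open Scope ring_scope.
Implicit Types (z : realization R (ucover x0)) (a b : pi1 x0).

Lemma udeckM a b z : udeck (a * b)%g z = udeck a (udeck b z).
Proof.
by case: z => [p|ue t] /=; rewrite ?udeck_vertexM ?udeck_edgeM.
Qed.

Lemma udeck1 z : udeck 1%g z = z.
Proof.
case: z => [p|ue t] /=; first by rewrite udeck_vertex1.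
by congr Inn; apply: uedge_inj => //; exact: udeck_vertex1.
Qed.

Lemma udeck_free a b z : udeck a z = udeck b z -> a = b.
Proof.
case: z => [p|ue t] /= [e].
  by apply: (@udeck_vertex_free _ _ a b p); apply: val_inj.
by apply: (@udeck_vertex_free _ _ a b (usrc ue)); apply: val_inj.
Qed.

Lemma iter_udeck (g : realization R (ucover x0) -> realization R (ucover x0)) n k a z :
  (forall b y, g (udeck b y) = udeck b (g y)) ->
  iter n g z = udeck a z -> iter (n * k) g z = udeck (a ^+ k)%g z.
Proof.
move=> gC e; elim: k => [|k IHk]; first by rewrite muln0 expg0 udeck1.
have iterC b y : iter n g (udeck b y) = udeck b (iter n g y).
  by elim: (n) => //= m ->; rewrite gC.
by rewrite mulnS iterD IHk iterC e -udeckM expgSr.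
Qed.

(* In either case the height minus the parameter does not vanish at the ends of
   [e0], hence the fixed point is interior. *)
Lemma edge_fixed_point (ue e0 : uedge x0) (p q : uvertex x0)
    (g : realization R (ucover x0) -> realization R (ucover x0)) :
  continuous g -> g (Vtx (usrc e0 : vertex (ucover x0))) = Vtx (p : vertex (ucover x0)) ->
  g (Vtx (utgt e0 : vertex (ucover x0))) = Vtx (q : vertex (ucover x0)) ->
  uheight R ue p < 0 /\ 1 < uheight R ue q \/
  1 <= uheight R ue p /\ uheight R ue q <= 0 ->
  exists t, g (Inn (e0 : edge (ucover x0)) t) = Inn (ue : edge (ucover x0)) t.
Proof.
move=> gc gp gq hpq.
pose H : realization R (ucover x0) -> R :=
  interpolate (uheight R ue : vertex (ucover x0) -> R).
pose c : R -> realization R (ucover x0) := charmap (e0 : edge (ucover x0)).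
pose phi (t : R) := H (g (c t)) - t.
have phic : continuous phi.
  move=> t; apply: cvgB; last exact: cvg_id.
  apply: (@continuous_comp _ _ _ (g \o c) H); last exact: interpolate_continuous.
  by apply: continuous_comp; [exact: charmap_continuous|exact: gc].
have {gp} phi0 : phi 0 = uheight R ue p by rewrite /phi /c charmap0 /= gp /= subr0.
have {gq} phi1 : phi 1 = uheight R ue q - 1 by rewrite /phi /c charmap1 /= gq.
have [||t t01 phit] := @IVT R phi 0 1 0 ler01.
- exact: continuous_subspaceT.
- by rewrite phi0 phi1 ge_min le_max; case: hpq => -[h1 h2]; apply/andP; split; apply/orP; lra.
move: t01; rewrite in_itv /= => /andP[t0 t1].
have {}t0 : 0 < t.
  rewrite lt_def t0 andbT; apply/eqP => e.
  by move: phit; rewrite e phi0; case: hpq => -[]; lra.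
have {}t1 : t < 1.
  rewrite lt_def t1 andbT eq_sym; apply/eqP => e.
  by move: phit; rewrite e phi1; case: hpq => -[]; lra.
have ht : 0 < t < 1 by rewrite t0 t1.
pose u : {t : R | 0 < t < 1} := exist _ t ht.
exists u; move: phit; rewrite /phi /c -[t in charmap _ t]/(val u) charmap_inside.
(* The image has height [t], strictly between 0 and 1, and no vertex has such a height. *)
case: (g _) => [v|ue' t'] /=.
  move=> e; exfalso; move: e; rewrite /uheight.
  by case: (word_height_cases R ((val ue).2, true) (upath (usrc ue) v)) => *; lra.
have /andP[t'0 t'1] := valP t'.
have [->|ne] := pselect (ue' = ue).
  rewrite uheight_src uheight_tgt => e; congr Inn; apply: val_inj => /=.
  by move: e; rewrite add0r subr0 mulr1; lra.
(* On any other edge the height is a convex combination of two values that are both at most 0 or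
   both at least 1. *)
move=> e; exfalso; move: e t0 t1 t'0 t'1 (uheight_edge R ne).
rewrite -/(uheight R ue _) /=.
move: (val t') (uheight R ue _) (uheight R ue _) => s y x e t0 t1 s0 s1.
case=> -[hx hy].
  have h1 : (1 - s) * x <= 0 by apply: mulr_ge0_le0 => //; lra.
  have h2 : s * y <= 0 by apply: mulr_ge0_le0 => //; lra.
  lra.
have h1 : 0 <= (1 - s) * (x - 1) by apply: mulr_ge0; lra.
have h2 : 0 <= s * (y - 1) by apply: mulr_ge0; lra.
lra.
Qed.

End Cover.

(** * Rotation elements *)

Section Syndetic.
Variables (G : digraph) (x0 : vertex G).
Implicit Types (s t u c : seq (dart G)) (P : pred (dart G)) (g x y : pi1 x0).

Lemma syndetic_red_cat P M N s t : reduced s -> reduced t ->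
  syndetic P M s -> syndetic P N t -> syndetic P (M + N) (red (s ++ t)).
Proof.
move=> hs ht ps pt; have [i [j ->]] := red_cat_split hs ht.
by apply: syndetic_cat; [exact: syndetic_take|exact: syndetic_drop].
Qed.

Lemma syndetic_mulg P M N x y : syndetic P M (val x) -> syndetic P N (val y) ->
  syndetic P (M + N) (val (x * y)%g).
Proof. by apply: syndetic_red_cat; exact: pi1_reduced. Qed.

Lemma expg_conj g x n : ((g * x * g^-1) ^+ n = g * x ^+ n * g^-1)%g.
Proof.
elim: n => [|n IHn]; first by rewrite !expg0 mulg1 mulgV.
by rewrite !expgS IHn !mulgA mulgKV.
Qed.

(** Taking powers repeats only the cyclic core [c]; the conjugating parts occur once, so the
    constant does not depend on [n]. *)
Lemma syndetic_expg P g x u c : val x = u ++ c ++ rev_path u -> cyc_reduced c ->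
  has P c -> exists M, forall n, syndetic P M (val ((g * x * g^-1) ^+ n)%g).
Proof.
move=> ex hc Pc; have := pi1_reduced x; rewrite ex => /reduced_cat[hu].
move=> /reduced_cat[_ hu'].
eexists=> n; rewrite expg_conj.
apply: syndetic_mulg (@syndetic_size _ P (val g^-1)%g).
apply: syndetic_mulg (@syndetic_size _ P (val g)) _.
rewrite val_expg ex red_wpow_conj -red_catr.
have hw : reduced (wpow c n) by exact/cyc_reduced_reduced/cyc_reduced_wpow.
apply: syndetic_red_cat; [exact: hu|exact: red_reduced|exact: syndetic_size|].
apply: syndetic_red_cat => //; last exact: syndetic_size.
exact: syndetic_wpow.
Qed.

(** Isolates the only factor of the geodesic word that varies with the translations. *)
Lemma upath_deck g x (p q : uvertex x0) :
  upath (udeck_vertex g p) (udeck_vertex x q) =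
  red (rev_path (val p) ++ val (g^-1 * x)%g ++ val q).
Proof.
rewrite val_mulg val_invg red_catlr /upath /= -red_rev red_catl red_catr.
by rewrite rev_path_cat -!catA.
Qed.

End Syndetic.

(** There are finitely many words of length at most [N] over a finite alphabet. *)
Lemma seq_pigeonhole (T : finType) N (F : nat -> seq T) :
  (forall k, (size (F k) <= N)%N) -> exists i j, (i < j)%N /\ F i = F j.
Proof.
move=> hF; pose h (k : 'I_(#|{: N.-bseq T}|.+1)) : N.-bseq T := Bseq (hF k).
have /injectivePn[i [j ij /(congr1 val) /= e]] : ~~ injectiveb h.
  by apply/injectiveP => /leq_card; rewrite card_ord ltnn.
by case: (ltngtP i j) => h'; [exists i, j|exists j, i|case/eqP: ij; exact: val_inj].
Qed.

Lemma index_pigeonhole (T : eqType) (J : seq T) m (h : T -> nat) : uniq J ->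
  (forall i, i \in J -> (h i < m)%N) -> (m < size J)%N ->
  exists i j, [/\ i \in J, j \in J, i != j & h i = h j].
Proof.
move=> uJ hJ mJ; apply: contrapT => no; move: mJ; rewrite ltnNge => /negP; apply.
rewrite -(size_map h) -[leqRHS](size_iota 0 m).
apply: uniq_leq_size => [|k /mapP[i iJ ->]]; last by rewrite mem_iota hJ.
rewrite map_inj_in_uniq // => i j iJ jJ e; apply: contrapT => /eqP ij.
by apply: no; exists i, j.
Qed.

(** The 2 pays for the first and the last position. *)
Lemma count_interior (T : Type) (d : T) (P : pred T) (s : seq T) :
  (count P s <= size [seq i <- iota 0 (size s) |
     [&& P (nth d s i), 0 < i & i.+1 < size s]] + 2)%N.
Proof.
pose A i := P (nth d s i); pose B i := (0 < i)%N && (i.+1 < size s)%N.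
have -> : count P s = count A (iota 0 (size s)).
  by rewrite -[s in LHS](mkseq_nth d) /mkseq count_map.
rewrite size_filter -/A; set I := iota _ _.
have nB : (count (predC B) I <= 2)%N.
  rewrite -size_filter; apply: (@uniq_leq_size _ _ [:: 0; (size s).-1]%N).
    by rewrite filter_uniq // iota_uniq.
  by move=> i; rewrite mem_filter mem_iota !inE /B /=; lia.
apply: leq_trans (leq_add (leqnn _) nB); rewrite -count_predUI.
apply: leq_trans (leq_addr _ _); apply: sub_count => i /= Ai.
by rewrite -/(A i) Ai /= -/(B i) orbN.
Qed.

(** * Rotation elements of points of the graph and of vertices of the tree *)

Section Dynamics.
Variables (R : realType) (G : finDigraph) (x0 : vertex G).
Variables (f : realization R G -> realization R G).
Variables (ft : realization R (ucover x0) -> realization R (ucover x0)).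
Hypothesis ft_lift : equivariant_lift f ft.
Variable L : coherent_labeling x0.
Implicit Types (x y z : realization R G) (r s t : group_root (pi1 x0)).
Implicit Types (p q : uvertex x0) (a b g : pi1 x0).

Lemma uproj_iter n (u : realization R (ucover x0)) :
  uproj (iter n ft u) = iter n f (uproj u).
Proof. by case: ft_lift => _ h _; elim: n => //= n <-. Qed.

Lemma iter_ft_deck n a u : iter n ft (udeck a u) = udeck a (iter n ft u).
Proof. by case: ft_lift => _ _ h; elim: n => //= n ->. Qed.

Lemma iter_ft_continuous n : continuous (iter n ft).
Proof.
case: ft_lift => h _ _; elim: n => [|n IHn] u; first exact: cvg_id.
by apply: continuous_comp; [exact: IHn|exact: h].
Qed.

Lemma uproj_deck a (u : realization R (ucover x0)) : uproj (udeck a u) = uproj u.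
Proof. by case: u => [p|ue t] //=; rewrite uend_deck. Qed.

Lemma uproj_clift x : uproj (clift_point L x) = x.
Proof. by case: x => [v|e t] //=; rewrite cliftK. Qed.

Lemma rotation_elementP x g n : (0 < n)%N ->
  iter n ft (clift_point L x) = udeck g (clift_point L x) ->
  rotation_element f ft L x (g, n).
Proof.
by move=> n0 e; split => //=; rewrite -[x]uproj_clift -uproj_iter e uproj_deck.
Qed.

(** At the common period [r.2 * s.2] both powers translate the same lifted point, and the deck group
    acts freely. *)
Lemma rotation_element_eq x r s : rotation_element f ft L x r ->
  rotation_element f ft L x s -> group_root_eq r s.
Proof.
case: ft_lift => _ _ h [_ _ hr] [_ _ hs].
apply: (@udeck_free R _ _ _ _ (clift_point L x)).
by rewrite -(iter_udeck _ h hr) mulnC (iter_udeck _ h hs).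
Qed.

(** The two sides agree after raising to the power [s.2], which uniqueness of roots removes. *)
Lemma group_root_eq_trans r s t : (0 < s.2)%N ->
  group_root_eq r s -> group_root_eq s t -> group_root_eq r t.
Proof.
rewrite /group_root_eq => s0 rs st; apply: (pi1_root_uniq s0).
by rewrite -!expgM mulnC expgM rs -expgM mulnC expgM st -!expgM mulnC.
Qed.

(** Existential because a rotation element has many representatives; [same_rotation_eq] extends the
    equality to all of them. *)
Definition same_rotation x y : Prop := exists r s,
  [/\ rotation_element f ft L x r, rotation_element f ft L y s & group_root_eq r s].

Lemma same_rotation_sym x y : same_rotation x y -> same_rotation y x.
Proof. by move=> [r [s [hr hs e]]]; exists s, r. Qed.

Lemma same_rotation_eq x y r s : same_rotation x y ->
  rotation_element f ft L x r -> rotation_element f ft L y s -> group_root_eq r s.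
Proof.
move=> [r' [s' [hr' hs' e]]] hr hs.
have [r0 _ _] := hr'; have [s0 _ _] := hs'.
apply: (group_root_eq_trans r0 (rotation_element_eq hr hr')).
exact: (group_root_eq_trans s0 e (rotation_element_eq hs' hs)).
Qed.

Lemma same_rotation_trans x y z :
  same_rotation x y -> same_rotation y z -> same_rotation x z.
Proof.
move=> [r [s [hr hs e]]] [s' [t [hs' ht e']]]; exists r, t; split => //.
have [s0 _ _] := hs; have [s0' _ _] := hs'.
apply: (group_root_eq_trans s0 e).
exact: (group_root_eq_trans s0' (rotation_element_eq hs hs') e').
Qed.

Variable sigma : {perm (fvertex G)}.
Hypothesis f_vertices : forall v : vertex G, f (Vtx v) = Vtx (sigma v : vertex G).
Hypothesis one_orbit : forall v : fvertex G, porbit sigma v = [set: fvertex G]%SET.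

Local Notation n0 := #|fvertex G|.
Local Notation uvtx p := (Vtx (p : vertex (ucover x0))).

Lemma iter_ft_vertex k p : exists2 q,
  iter k ft (uvtx p) = uvtx q & uend q = iter k sigma (uend p).
Proof.
have : uproj (iter k ft (uvtx p)) = Vtx (iter k sigma (uend p) : vertex G).
  by rewrite uproj_iter /=; elim: k => //= k ->; rewrite f_vertices.
by case: (iter k ft _) => [q|//] [e]; exists q.
Qed.

(** This is [a(p)]. As the vertices form one orbit, the single period [n0] serves all of them. *)
Definition vertex_rotation p a := iter n0 ft (uvtx p) = uvtx (udeck_vertex a p).

Lemma vertex_rotation_ex p : exists a, vertex_rotation p a.
Proof.
have [q eq uq] := iter_ft_vertex n0 p.
have e : uend p = uend q.
  by rewrite uq -cardsT -(one_orbit (uend p)) iter_porbit.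
by have [a ea] := udeck_vertex_trans e; exists a; rewrite /vertex_rotation eq ea.
Qed.

Lemma vertex_rotation_uniq p a b :
  vertex_rotation p a -> vertex_rotation p b -> a = b.
Proof.
move=> ha hb; apply: (@udeck_free R _ _ _ _ (uvtx p)).
by rewrite -[LHS]ha hb.
Qed.

Lemma vertex_rotation_deck p a g :
  vertex_rotation p a -> vertex_rotation (udeck_vertex g p) (g * a * g^-1)%g.
Proof.
move=> h; rewrite /vertex_rotation -!udeck_vertexM mulgKV udeck_vertexM.
by rewrite -[uvtx (udeck_vertex g p)]/(udeck g (uvtx p)) iter_ft_deck h.
Qed.

(** Some iterate of [p] lies over the same vertex as [q]. Iteration keeps the rotation element, and
    a translation conjugates it. *)
Lemma vertex_rotation_conj p w q : vertex_rotation p w ->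
  exists g, vertex_rotation q (g * w * g^-1)%g.
Proof.
move=> hw; have : uend q \in porbit sigma (uend p) by rewrite one_orbit inE.
case/porbitP => i; rewrite permX => ei.
have [p' ep' up'] := iter_ft_vertex i p.
have [|g ->] := @udeck_vertex_trans _ _ p' q; first by rewrite up' ei.
exists g; apply: vertex_rotation_deck; rewrite /vertex_rotation.
by rewrite -ep' -iterD addnC iterD hw -[uvtx _]/(udeck w (uvtx p)) iter_ft_deck ep'.
Qed.

Lemma vertex_rotation_iter p a k : vertex_rotation p a ->
  iter (n0 * k) ft (uvtx p) = uvtx (udeck_vertex (a ^+ k)%g p).
Proof. by case: ft_lift => _ _ h ha; rewrite (@iter_udeck _ _ _ _ n0 k a). Qed.

Lemma edge_rotation_neq p (w : pi1 x0) : (exists z : pi1 x0, w * z != z * w)%g ->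
  vertex_rotation p w -> exists e : edge G, exists a b,
  [/\ vertex_rotation (usrc (clift_edge L e)) a,
      vertex_rotation (utgt (clift_edge L e)) b & a != b].
Proof.
move=> [z wz] hw; apply: contrapT => no.
have noL e a : vertex_rotation (usrc (clift_edge L e)) a ->
    vertex_rotation (utgt (clift_edge L e)) a.
  move=> ha; have [b hb] := vertex_rotation_ex (utgt (clift_edge L e)).
  have [<-//|ab] := eqVneq b a; case: no; exists e, a, b; split=> //.
  by rewrite eq_sym.
(* Every edge of the tree is a translate of a chosen lift, so the agreement is transported by
   conjugation. *)
have noE ue a : vertex_rotation (usrc ue) a -> vertex_rotation (utgt ue) a.
  have eu : uend (usrc ue) = src (val ue).2 by exact/eqP/(valP ue).
  have [|g eg] := @udeck_vertex_trans _ _ (usrc (clift_edge L (val ue).2)) (usrc ue).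
    by rewrite eu /= cliftK.
  have -> : ue = udeck_edge g (clift_edge L (val ue).2) by exact: uedge_inj.
  rewrite utgt_deck => ha.
  have := noL (val ue).2 (g^-1 * a * g)%g.
  have /(vertex_rotation_deck g^-1%g) := ha.
  rewrite invgK -udeck_vertexM mulVg udeck_vertex1 => h1 /(_ h1).
  move=> /(vertex_rotation_deck g).
  by rewrite !mulgA mulgV mul1g mulgK.
(* Induction on the distance from the base point. *)
have rot a : vertex_rotation (ubase x0) a -> forall q, vertex_rotation q a.
  move=> ha q; have [n] := ubnP (size (val q)); elim: n q => // n IHn q.
  case/lastP E : (val q) => [|s d] qn.
    by have -> : q = ubase x0 by exact: val_inj.
  have := valP q; rewrite E -cats1 walk_cat => /andP[/andP[ws wd] /reduced_cat[rs _]].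
  have hp : walk x0 s && reduced s by rewrite ws.
  pose p' : uvertex x0 := Sub s hp.
  have {qn} hp' : vertex_rotation p' a by apply: IHn; rewrite size_rcons in qn.
  case: d E wd => e [] E /= /andP[/eqP wd _]; rewrite /dsrc /= in wd.
    have up' : uend p' = src e by exact: esym.
    have -> : q = utgt (lift_edge up'); last exact: noE.
    apply: val_inj; rewrite /= cats1 -E red_id //; exact: uvertex_reduced.
  (* The last letter is traversed backwards, so the edge issues from [q]: the rotation element of
     [q] is carried to [p'] and identified there by uniqueness. *)
  have uq : uend q = src e.
    by rewrite /uend E -cats1 wend_cat.
  have [a' ha'] := vertex_rotation_ex q.
  have ep' : p' = utgt (lift_edge uq).
    apply: val_inj => /=; rewrite E -cats1 -catA -red_catr /= eqxx cats0.
    by rewrite red_id.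
  have := noE (lift_edge uq) a' ha'; rewrite -ep' => /(vertex_rotation_uniq hp') ->.
  exact: ha'.
have [a ha] := vertex_rotation_ex (ubase x0).
have wa := vertex_rotation_uniq hw (rot a ha p).
case/eqP: wz; rewrite wa.
(* The translate of the base point by [z] carries both [a] and [z a z^-1], so [z] commutes with [a],
   which is [w]. *)
have /(vertex_rotation_uniq (rot a ha (udeck_vertex z (ubase x0)))) :=
  vertex_rotation_deck z ha.
by move/(congr1 (fun b => b * z)%g); rewrite mulgKV => ->.
Qed.

(** * Translates of an edge crossed by its iterated images *)

Section EdgeCrossings.
Variables (e : edge G) (a b : pi1 x0).
Let e0 := clift_edge L e.
Hypothesis rot_a : vertex_rotation (usrc e0) a.
Hypothesis rot_b : vertex_rotation (utgt e0) b.

(** [left k] and [right k] are the images of the ends of [e0] under the iterate [n0 * k] of the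
    lift. *)
Let left k := udeck_vertex (a ^+ k)%g (usrc e0).
Let right k := udeck_vertex (b ^+ k)%g (utgt e0).

(** A crossing of the translate of [e0] by [g] yields a point of [e0] that the lifted iterate moves
    by [g]. The second clause locates the initial vertex of the translate on the geodesic, one
    letter later for a backward crossing; it serves to tell translates apart. *)
Lemma crossing_rotation d k i : (0 < n0 * k)%N -> (0 < i)%N ->
  (i.+1 < size (upath (left k) (right k)))%N ->
  (nth d (upath (left k) (right k)) i).1 = e ->
  exists x g, rotation_element f ft L x (g, (n0 * k)%N) /\
    upath (left k) (udeck_vertex g (usrc e0)) =
    take (i + ~~ (nth d (upath (left k) (right k)) i).2) (upath (left k) (right k)).
Proof.
set s := upath _ _ => k0 i0 si ei; have si' : (i < size s)%N by lia.
case E : (nth d s i) ei => [e' bi] /= ee; rewrite {e'}ee in E.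
have es : upath (left k) (right k) = take i s ++ (e, bi) :: drop i.+1 s.
  by rewrite -E -drop_nth // cat_take_drop.
have [||ue [ue2 pue hue]] := uheight_crossing R es.
- by rewrite size_takel // ltnW.
- by rewrite size_drop; lia.
have [|g eg] := @udeck_vertex_trans _ _ (usrc e0) (usrc ue).
  by rewrite (eqP (valP ue)) ue2 /= cliftK.
have eue : ue = udeck_edge g e0 by exact: uedge_inj.
have [t ht] := edge_fixed_point (@iter_ft_continuous (n0 * k))
  (vertex_rotation_iter k rot_a) (vertex_rotation_iter k rot_b) hue.
exists (Inn e t), g; split; first by apply: rotation_elementP => //; rewrite ht eue.
rewrite -eg pue; case: bi E {es pue}=> E; first by rewrite addn0.
by rewrite addn1 (take_nth d) // E.
Qed.

(** Boundedly many crossings would bound the length of the geodesics, by syndeticity with a constant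
    independent of [k]; two of the words would then coincide. *)
Lemma crossings_unbounded (w g h : pi1 x0) : belongs e w ->
  a = (g * w * g^-1)%g -> b = (h * w * h^-1)%g -> a != b ->
  forall n, exists k, (n <= count (fun d => d.1 == e) (upath (left k.+1) (right k.+1)))%N.
Proof.
move=> ew ea eb ab n; pose P (d : dart G) := d.1 == e; apply: contrapT => no.
have [u [c [ewu hc /(_ _ ew) Pc]]] := belongs_cyclic_decomposition w.
(* The geodesic involves the inverse of [a ^+ k], a power of a conjugate of [w^-1], whose cyclic
   core is [c] reversed; [P] ignores orientation. *)
have ewV : val w^-1%g = u ++ rev_path c ++ rev_path u.
  by rewrite val_invg ewu !rev_path_cat rev_pathK catA.
have hcV : cyc_reduced (rev_path c) by rewrite cyc_reduced_rev.
have PcV : has P (rev_path c) by rewrite /rev_path has_rev has_map.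
have [M hM] := syndetic_expg (P := P) g ewV hcV PcV.
have [N hN] := syndetic_expg (P := P) h ewu hc Pc.
pose K := (size (rev_path (val (usrc e0))) + (M + N + size (val (utgt e0))))%N.
have hK k : syndetic P K (upath (left k) (right k)).
  rewrite /left /right upath_deck -red_catr.
  apply: syndetic_red_cat; rewrite ?red_reduced ?reduced_rev ?uvertex_reduced //.
    exact: syndetic_size.
  apply: syndetic_red_cat; rewrite ?pi1_reduced ?uvertex_reduced //.
    apply: syndetic_mulg; last by rewrite eb; exact: hN.
    by rewrite ea -expgVn !invgM invgK mulgA; exact: hM.
  exact: syndetic_size.
have sz k : (size (upath (left k.+1) (right k.+1)) <= n.+1 * K)%N.
  have := hK k.+1 0%N (size (upath (left k.+1) (right k.+1))).
  rewrite drop0 take_size => /leq_trans; apply; rewrite leq_mul2r ltnS; apply/orP; right.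
  by rewrite leqNgt; apply/negP => h'; apply: no; exists k; exact: ltnW.
have [i [j [ij]]] : exists i j, (i < j)%N /\
    upath (left i.+1) (right i.+1) = upath (left j.+1) (right j.+1).
  exact: (@seq_pigeonhole (fedge G * bool)%type _ _ sz).
(* Removing the fixed outer words leaves [a^-(i+1) b^(i+1) = a^-(j+1) b^(j+1)], so [a] and [b] have
   the same power [j - i], against uniqueness of roots. *)
rewrite /left /right !upath_deck => /red_catIl /red_catIr.
rewrite !red_id ?pi1_reduced // => /val_inj e'.
case/eqP: ab; apply: (@pi1_root_uniq _ _ a b (j - i)%N); first by rewrite subn_gt0.
have ej : j.+1 = ((j - i) + i.+1)%N by lia.
move: e'; rewrite ej !expgnDr.
move=> /(congr1 (fun x : pi1 x0 => (a ^+ (j - i) * a ^+ i.+1) * x * (b ^+ i.+1)^-1)%g).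
by rewrite mulKVg mulgA !mulgK.
Qed.

(** With more interior crossings than members of [l], two crossings would share the rotation of one
    member. Having the same exponent, they would come from the same translate of the edge, which a
    geodesic crosses only once. *)
Lemma rotation_escape (w g h : pi1 x0) : (0 < n0)%N -> belongs e w ->
  a = (g * w * g^-1)%g -> b = (h * w * h^-1)%g -> a != b ->
  forall l : seq (realization R G), exists x r,
    rotation_element f ft L x r /\ forall y, y \in l -> ~ same_rotation x y.
Proof.
move=> n0_gt0 ew ea eb ab l; apply: contrapT => no.
(* Two crossings may be lost at the ends of the geodesic; one more makes the pigeonhole strict. *)
have [k] := crossings_unbounded ew ea eb ab (size l).+3.
set s := upath _ _ => hk; pose d : dart G := (e, true).
pose J := [seq i <- iota 0 (size s) | [&& (nth d s i).1 == e, 0 < i & i.+1 < size s]%N].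
have sJ : (size l < size J)%N.
  by have := leq_trans hk (count_interior d _ s); rewrite -/J; lia.
have JP (i : nat) : i \in J -> [/\ (nth d s i).1 = e, (0 < i)%N & (i.+1 < size s)%N].
  by rewrite mem_filter => /andP[/and3P[/eqP]].
(* [c i] is the index in [l] of a member with the rotation of the crossing [i]; outside [J] its
   value is arbitrary. *)
have /choice[c hc] : forall i, exists m, i \in J -> (m < size l)%N /\
    exists x (u : pi1 x0), [/\ rotation_element f ft L x (u, (n0 * k.+1)%N),
        upath (left k.+1) (udeck_vertex u (usrc e0)) = take (i + ~~ (nth d s i).2) s &
        same_rotation x (nth x l m)].
  move=> i; have [iJ|] := boolP (i \in J); last by exists 0%N.
  have [ei i0 si] := JP i iJ.
  have [|x [p [hx hp]]] := crossing_rotation _ i0 si ei; first by rewrite muln_gt0 n0_gt0.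
  have [y yl xy] : exists2 y, y \in l & same_rotation x y.
    apply: contrapT => no'; apply: no; exists x, (p, (n0 * k.+1)%N); split => // y yl xy.
    by apply: no'; exists y.
  exists (index y l) => _; rewrite index_mem; split => //; exists x, p; split => //.
  by rewrite nth_index.
have uJ : uniq J by rewrite filter_uniq // iota_uniq.
have [i [j [iJ jJ ij eij]]] := index_pigeonhole uJ (fun i iJ => (hc i iJ).1) sJ.
wlog lij : i j iJ jJ ij eij / (i < j)%N => [th|].
  by case: (ltngtP i j) => [|ji|e']; [exact: th|apply: (th j i); rewrite // eq_sym|rewrite e' eqxx in ij].
have [ci [x [p [hx hp xx]]]] := hc i iJ; have [cj [y [q [hy hq yy]]]] := hc j jJ.
have xy : same_rotation x y.
  apply: same_rotation_trans xx _; apply: same_rotation_sym.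
  by rewrite eij (set_nth_default y).
have : (p, (n0 * k.+1)%N).1 = (q, (n0 * k.+1)%N).1.
  have /(pi1_root_uniq _) := same_rotation_eq xy hx hy; apply.
  by rewrite muln_gt0 n0_gt0.
(* Equal translates start at equal distances from [left k.+1]. With [i < j] this leaves only a
   backward crossing immediately followed by a forward one, which a reduced word excludes. *)
move=> /= epq; rewrite epq hq in hp; have := congr1 size hp.
have [ei i0 si] := JP i iJ; have [ej j0 sj] := JP j jJ.
rewrite !size_takel; [|by case: (_.2); lia|by case: (_.2); lia].
case Ei : (nth d s i) ei => [e1 []] /= ?; case Ej : (nth d s j) ej => [e2 []] /= ?; try lia.
move=> eji; have {eji} eji : j = i.+1 by lia.
have /sortedP := upath_reduced (left k.+1) (right k.+1).
move=> /(_ d i si); rewrite -/s -eji Ei Ej /no_backtrack.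
by subst e1 e2; rewrite eqxx.
Qed.

End EdgeCrossings.
End Dynamics.

(** * Choice of infinitely many orbits, and conclusion *)

(** Points are chosen greedily, each avoiding the finite list of its predecessors; reflexivity of
    [bad] makes the sequence injective. *)
Lemma infinite_independent_set (T : eqType) (P : set T) (bad : T -> T -> Prop) :
  (forall x, bad x x) -> (forall x y, bad x y -> bad y x) ->
  (forall l : seq T, (forall y, y \in l -> P y) ->
    exists2 x, P x & forall y, y \in l -> ~ bad x y) ->
  exists A : set T, [/\ infinite_set A, A `<=` P &
    forall x y, A x -> A y -> x <> y -> ~ bad x y].
Proof.
move=> refl sym ext.
(* The condition on [l] stands under the existential so that [next] is total; on other lists its
   value is arbitrary. *)
have /choice[next hnext] : forall l : seq T, exists x,
    (forall y, y \in l -> P y) -> P x /\ forall y, y \in l -> ~ bad x y.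
  move=> l; have [h|h] := pselect (forall y, y \in l -> P y).
    by have [x Px hx] := ext l h; exists x.
  by have [//|x _ _] := ext [::]; exists x.
pose hist n := iter n (fun l => next l :: l) [::].
pose u n := next (hist n).
have histP n y : y \in hist n -> P y.
  elim: n y => //= n IHn y; rewrite inE => /orP[/eqP ->|]; last exact: IHn.
  by have [] := hnext _ IHn.
have histu i n : (i < n)%N -> u i \in hist n.
  elim: n => // n IHn; rewrite ltnS leq_eqVlt inE => /orP[/eqP ->|/IHn ->].
    by rewrite eqxx.
  by rewrite orbT.
have sep i j : (i < j)%N -> ~ bad (u j) (u i).
  by move=> /histu; have [_] := hnext _ (histP j); apply.
have u_inj : injective u.
  move=> i j e; case: (ltngtP i j) => // /sep; rewrite e => /(_ (refl _)) //.
exists (range u); split.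
- apply/infiniteP; have := @inj_card_eq _ _ setT u (in2W u_inj).
  by rewrite card_eq_le => /andP[].
- by move=> _ [i _ <-]; have [] := hnext _ (histP i).
- move=> _ _ [i _ <-] [j _ <-] ne; case: (ltngtP i j) => [/sep h /sym //|/sep //|e].
  by rewrite e in ne.
Qed.

Lemma iter_modn (T : Type) (f : T -> T) x n k :
  iter n f x = x -> iter k f x = iter (k %% n) f x.
Proof.
move=> e; rewrite [in LHS](divn_eq k n) addnC iterD; congr (iter _ _ _).
by elim: (k %/ n)%N => // q IHq; rewrite mulSn iterD IHq e.
Qed.

Theorem theorem33 (R : realType) (G : finDigraph) (x0 : vertex G)
  (G_connected : connected_digraph G)
  (pi_free : exists2 r : nat, (2 <= r)%N & free_of_rank (pi1 x0) r)
  (L : coherent_labeling x0)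
  (f : realization R G -> realization R G)
  (f_continuous : continuous f)
  (f_homotopic : homotopic R f id)
  (sigma : {perm (fvertex G)})
  (f_vertices : forall v : vertex G, f (Vtx v) = Vtx (sigma v : vertex G))
  (one_orbit : forall v : fvertex G, porbit sigma v = [set: fvertex G]%SET)
  (ft : realization R (ucover x0) -> realization R (ucover x0))
  (ft_lift : equivariant_lift f ft)
  (V : vertex G) (w : pi1 x0)
  (w_rotation : rotation_element f ft L (Vtx V) (w, #|fvertex G|))
  (w_edges : forall e : edge G, belongs e w) :
  exists A : set (realization R G),
    [/\ infinite_set A,
        forall x, A x ->
          periodic_point f x /\ exists r, rotation_element f ft L x r,
        forall x y, A x -> A y -> x <> y ->
          forward_orbit f x <> forward_orbit f y &
        forall x y rx ry, A x -> A y -> x <> y ->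
          rotation_element f ft L x rx -> rotation_element f ft L y ry ->
          ~ group_root_eq rx ry].
Proof.
have [n_gt0 _ wL] := w_rotation.
have [r r2 [bas hbas]] := pi_free.
have [z0 z0_neq1] := free_nontrivial (ltnW r2) hbas.
(* A nontrivial loop has a letter, hence the graph has an edge. *)
have [e1 _] : exists e : edge G, True.
  case E : (val z0) => [|d s]; last by exists d.1.
  by case/eqP: z0_neq1; exact: val_inj.
(* The empty word is a cyclic reduction of the identity and uses no edge. *)
have w_neq1 : w <> 1%g.
  move=> w1; suff : e1 \in map fst ([::] : seq (dart G)) by [].
  by apply: (w_edges e1); split=> //; rewrite w1; exact: contracts_refl.
have wC : exists z, (w * z != z * w)%g.
  apply: contrapT => no; apply: w_neq1; apply: (free_center r2 hbas) => x.
  by apply: contrapT => wx; apply: no; exists x; exact/eqP.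
have rot_w : vertex_rotation ft (clift L V) w := wL.
have [e [a [b [rot_a rot_b ab]]]] :=
  edge_rotation_neq ft_lift L f_vertices one_orbit wC rot_w.
have [g] := vertex_rotation_conj ft_lift f_vertices one_orbit (usrc (clift_edge L e)) rot_w.
move=> /(vertex_rotation_uniq rot_a) ea.
have [h] := vertex_rotation_conj ft_lift f_vertices one_orbit (utgt (clift_edge L e)) rot_w.
move=> /(vertex_rotation_uniq rot_b) eb.
have escape := rotation_escape ft_lift rot_a rot_b n_gt0 (w_edges e) ea eb ab.
pose bad x y := same_rotation f ft L x y \/ forward_orbit f x = forward_orbit f y.
pose P := [set x | exists r, rotation_element f ft L x r].
have [||l lP|A [Ainf AP Abad]] := @infinite_independent_set _ P bad.
- by move=> x; right.
- by move=> x y [/same_rotation_sym xy|exy]; [left|right].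
- have /choice[n hn] : forall y, exists n, P y -> (0 < n)%N /\ iter n f y = y.
    move=> y; have [[s [s0 fs _]]|nP] := pselect (P y); last by exists 0%N.
    by exists s.2.
  (* The list to avoid also contains the finite orbits of the members of [l]: a point with the same
     orbit as one of them would be in the list and have the same rotation as itself. *)
  have [x [s [hx xl]]] :=
    escape (l ++ flatten [seq [seq iter k f y | k <- iota 0 (n y)] | y <- l]).
  exists x; first by exists s.
  move=> y yl [|exy]; first by apply: xl; rewrite mem_cat yl.
  apply: (xl x); last by exists s, s.
  rewrite mem_cat; apply/orP; right; apply/flattenP.
  exists [seq iter k f y | k <- iota 0 (n y)]; first by apply/mapP; exists y.
  have : forward_orbit f x x by exists 0%N.
  rewrite exy => -[k _ <-]; have [ny fy] := hn y (lP y yl).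
  apply/mapP; exists (k %% n y)%N; last exact: iter_modn.
  by rewrite mem_iota ltn_mod.
- exists A; split=> //.
  + move=> x Ax; have [s hs] := AP x Ax; split; last by exists s.
    by have [s0 fs _] := hs; exists s.2.
  + by move=> x y Ax Ay xy exy; apply: (Abad x y Ax Ay xy); right.
  + move=> x y rx ry Ax Ay xy hx hy exy; apply: (Abad x y Ax Ay xy).
    by left; exists rx, ry.
Qed.
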